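(* Let $\mathcal{S}$ be a probabilistic term rewrite system (PTRS) that is orthogonal and right-linear (equivalently, non-overlapping, left-linear and right-linear). Then $\mathcal{S}$ is fAST if and only if $\mathcal{S}$ is iAST, and $\mathcal{S}$ is fPAST if and only if $\mathcal{S}$ is iPAST.
   Context: Terms are built over a (possibly infinite) signature $\Sigma$ and a set of variables $\mathcal{V}$. A finite multi-distribution $\mu$ on a nonempty set $A$ is a finite multiset of pairs $(p:a)$ with $0<p\le 1$, $a\in A$, and $\sum_{(p:a)\in\mu}p=1$; $\operatorname{Supp}(\mu)$ is the multiset of the $a$'s; for $0<p\le1$, $p\cdot\mu=\{(p q:a)\mid (q:a)\in\mu\}$. A probabilistic rewrite rule is $\ell\to\mu$ with $\ell$ a non-variable term, $\mu$ a finite multi-distribution on terms, and every variable of each $r\in\operatorname{Supp}(\mu)$ occurring in $\ell$. A PTRS is a (possibly infinite) set $\mathcal{S}$ of such rules. We write $s\to_{\mathcal{S}}\{p_1:t_1,\dots,p_k:t_k\}$ if there are a position $\pi$, a rule $\ell\to\{p_1:r_1,\dots,p_k:r_k\}\in\mathcal{S}$ and a substitution $\sigma$ with $s|_\pi=\ell\sigma$ and $t_j=s[r_j\sigma]_\pi$ for all $j$. The step is innermost if all proper subterms of the redex $\ell\sigma$ are normal forms w.r.t. $\mathcal{S}$. The lifting $\rightrightarrows$ of a relation $\to\subseteq$ terms $\times$ multi-distributions is the smallest relation on finite multi-distributions with: $\{1:t\}\rightrightarrows\{1:t\}$ if $t$ is a normal form w.r.t. $\to$; $\{1:t\}\rightrightarrows\mu$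 if $t\to\mu$; and if $\mu_j\rightrightarrows\nu_j$ and $0<p_j\le1$ for $1\le j\le k$ with $\sum_j p_j=1$, then $\bigcup_j p_j\cdot\mu_j\rightrightarrows\bigcup_j p_j\cdot\nu_j$. For a multi-distribution $\mu$, $|\mu|_{\mathcal{S}}$ is the sum of the probabilities $p$ of the pairs $(p:t)\in\mu$ with $t$ a normal form w.r.t. $\mathcal{S}$. $\mathcal{S}$ is fAST (resp. iAST) if every infinite sequence $(\mu_n)_{n\in\mathbb{N}}$ with $\mu_n\rightrightarrows\mu_{n+1}$ for the lifting of full rewriting $\to_{\mathcal{S}}$ (resp. of innermost rewriting) satisfies $\lim_{n\to\infty}|\mu_n|_{\mathcal{S}}=1$. The expected derivation length of such a sequence is $\operatorname{edl}((\mu_n)_n)=\sum_{n=0}^\infty(1-|\mu_n|_{\mathcal{S}})$; $\mathcal{S}$ is fPAST (resp. iPAST) if every infinite such sequence for full (resp. innermost) rewriting has finite expected derivation length. Two rules $\ell_1\to\mu_1,\ell_2\to\mu_2$ (variables renamed apart) overlap if there is a non-variable position $\pi$ of $\ell_1$ such that $\ell_1|_\pi$ and $\ell_2$ are unifiable, where $\pi\neq\varepsilon$ is required if the two rules are the same rule; $\mathcal{S}$ is non-overlapping if no two of its rules overlap. $\mathcal{S}$ is left-linear if no variable occurs more than once in any left-hand side, right-linear if no variable occurs more than once in any $r\in\operatorname{Supp}(\mu)$ of any rule $\ell\to\mu$, linear if both, and orthogonal if non-overlapping and left-linear. *)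

(* Defs.v *)
From HB Require Import structures.
From mathcomp Require Import all_boot all_order all_algebra.
From mathcomp Require Import finmap multiset.
From mathcomp Require Import all_classical all_reals all_analysis.

Set Implicit Arguments.
Unset Strict Implicit.
Unset Printing Implicit Defensive.

Import Order.TTheory GRing.Theory Num.Theory.
Import numFieldNormedType.Exports.

Local Open Scope classical_set_scope.
Local Open Scope ring_scope.
Local Open Scope mset_scope.

(* Signatures and sets of variables are arbitrary: possibly infinite, possibly
   empty. *)
Record signature := Signature { symbol :> Type; arity : symbol -> nat }.

(* The induction principle generated by default ignores the recursive
   occurrences below {ffun _}; term_ind replaces it. *)
Unset Elimination Schemes.
Inductive term (F : signature) (V : Type) :=
| Var of V
| App (f : F) of {ffun 'I_(arity f) -> term F V}.
Set Elimination Schemes.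

Arguments Var {F V} x.
Arguments App {F V} f ts.

Lemma term_ind (F : signature) (V : Type) (K : term F V -> Prop) :
    (forall x, K (Var x)) ->
    (forall f (ts : {ffun 'I_(arity f) -> term F V}),
       (forall i, K (ts i)) -> K (App f ts)) ->
  forall t, K t.
Proof.
move=> KV KA; fix IHt 1 => -[x|f ts]; first exact: KV.
by apply: KA => i; apply: IHt.
Qed.

(* Classical equality and choice, needed to form multisets of terms. *)
HB.instance Definition _ (F : signature) (V : Type) := gen_eqMixin (term F V).
HB.instance Definition _ (F : signature) (V : Type) :=
  gen_choiceMixin (term F V).

Section Terms.
Variable F : signature.

Definition is_var (V : Type) (t : term F V) : bool :=
  if t is Var _ then true else false.

(* Variable occurrences, from left to right, with repetitions. *)
Fixpoint vars (V : Type) (t : term F V) : seq V :=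
  match t with
  | Var x => [:: x]
  | App f ts => flatten [seq vars (ts i) | i <- enum 'I_(arity f)]
  end.

Fixpoint subst (V W : Type) (sigma : V -> term F W) (t : term F V) : term F W :=
  match t with
  | Var x => sigma x
  | App f ts => App f [ffun i => subst sigma (ts i)]
  end.

(* Positions are sequences of argument indices, counted from 0; the root is
   [::].  The result is None when pi is not a position of t. *)
Fixpoint subterm_at (V : Type) (t : term F V) (pi : seq nat) :
    option (term F V) :=
  match pi, t with
  | [::], _ => Some t
  | i :: pi', App f ts =>
      if (insub i : option 'I_(arity f)) is Some j
      then subterm_at (ts j) pi' else None
  | _ :: _, Var _ => None
  end.

(* t[u]_pi; only used when pi is a position of t. *)
Fixpoint replace_at (V : Type) (t : term F V) (pi : seq nat) (u : term F V) :
    term F V :=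
  match pi, t with
  | [::], _ => u
  | i :: pi', App f ts =>
      App f [ffun j => if val j == i then replace_at (ts j) pi' u else ts j]
  | _ :: _, Var _ => t
  end.

Definition unifiable (W : Type) (s t : term F W) : Prop :=
  exists sigma : W -> term F W, subst sigma s = subst sigma t.

End Terms.

Section MultiDistributions.
Variable R : realType.

Definition is_mdist (A : choiceType) (mu : {mset R * A}) : Prop :=
  (forall x, x \in mu -> 0 < x.1 <= 1) /\ \sum_(x <- mu) x.1 = 1.

Definition mset_map (A B : choiceType) (f : A -> B) (mu : {mset A}) : {mset B} :=
  seq_mset [seq f x | x <- mu].

Definition mscale (A : choiceType) (p : R) (mu : {mset R * A}) : {mset R * A} :=
  mset_map (fun x => (p * x.1, x.2)) mu.

Definition mbigunion (A : choiceType) (k : nat) (mu : 'I_k -> {mset A}) :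
    {mset A} :=
  \big[@msetD A/mset0]_(j < k) mu j.

Definition normal_form (A : choiceType) (step : A -> {mset R * A} -> Prop)
    (a : A) : Prop :=
  ~ exists mu, step a mu.

(* Relates only multi-distributions as soon as [step] only has
   multi-distributions as results: see lifting_is_mdist. *)
Inductive lifting (A : choiceType) (step : A -> {mset R * A} -> Prop) :
    {mset R * A} -> {mset R * A} -> Prop :=
| lifting_nf a : normal_form step a -> lifting step [mset (1, a)] [mset (1, a)]
| lifting_step a mu : step a mu -> lifting step [mset (1, a)] mu
| lifting_union k (p : 'I_k -> R) (mu nu : 'I_k -> {mset R * A}) :
    (forall j, 0 < p j <= 1) -> \sum_(j < k) p j = 1 ->
    (forall j, lifting step (mu j) (nu j)) ->
    lifting step (mbigunion (fun j => mscale (p j) (mu j)))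
              (mbigunion (fun j => mscale (p j) (nu j))).

End MultiDistributions.

Section Rewriting.
Variables (R : realType) (F : signature) (V : eqType).
Implicit Types (s t u : term F V) (mu : {mset R * term F V}).

Record rule := Rule { lhs : term F V; rhs : {mset R * term F V} }.

Definition is_rule (r : rule) : Prop :=
  [/\ ~~ is_var (lhs r), is_mdist (rhs r) &
      forall x, x \in rhs r -> {subset vars x.2 <= vars (lhs r)}].

Definition is_ptrs (S : set rule) : Prop := forall r, S r -> is_rule r.

Definition rewrites_at (S : set rule) (pi : seq nat) s u mu : Prop :=
  exists (r : rule) (sigma : V -> term F V),
    [/\ S r, u = subst sigma (lhs r), subterm_at s pi = Some u &
        mu = mset_map (fun x => (x.1, replace_at s pi (subst sigma x.2)))
               (rhs r)].

Definition full_step (S : set rule) s mu : Prop :=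
  exists pi u, rewrites_at S pi s u mu.

Definition nf (S : set rule) t : Prop := normal_form (full_step S) t.

Definition innermost_step (S : set rule) s mu : Prop :=
  exists pi u, rewrites_at S pi s u mu /\
    forall pi' v, pi' <> [::] -> subterm_at u pi' = Some v -> nf S v.

Definition prob_nf (S : set rule) mu : R :=
  \sum_(x <- mu | `[< nf S x.2 >]) x.1.

Definition lifting_sequence (step : term F V -> {mset R * term F V} -> Prop)
    (mu : nat -> {mset R * term F V}) : Prop :=
  forall n, lifting step (mu n) (mu n.+1).

Definition edl (S : set rule) (mu : nat -> {mset R * term F V}) : \bar R :=
  (\sum_(0 <= n <oo) (1 - prob_nf S (mu n))%:E)%E.

Definition AST_for (step : term F V -> {mset R * term F V} -> Prop)
    (S : set rule) : Prop :=
  forall mu : nat -> {mset R * term F V}, lifting_sequence step mu ->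
    prob_nf S (mu n) @[n --> \oo] --> (1 : R).

Definition PAST_for (step : term F V -> {mset R * term F V} -> Prop)
    (S : set rule) : Prop :=
  forall mu : nat -> {mset R * term F V}, lifting_sequence step mu ->
    (edl S mu < +oo)%E.

Definition fAST (S : set rule) : Prop := AST_for (full_step S) S.
Definition iAST (S : set rule) : Prop := AST_for (innermost_step S) S.
Definition fPAST (S : set rule) : Prop := PAST_for (full_step S) S.
Definition iPAST (S : set rule) : Prop := PAST_for (innermost_step S) S.

(* The rules are renamed apart by moving them to the two summands of V + V. *)
Definition overlap (r1 r2 : rule) : Prop :=
  exists pi u,
    [/\ subterm_at (lhs r1) pi = Some u, ~~ is_var u,
        r1 = r2 -> pi <> [::] &
        unifiable (subst (fun x => Var (inl x : V + V)) u)
                  (subst (fun x => Var (inr x : V + V)) (lhs r2))].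

Definition non_overlapping (S : set rule) : Prop :=
  forall r1 r2, S r1 -> S r2 -> ~ overlap r1 r2.

Definition left_linear (S : set rule) : Prop :=
  forall r, S r -> uniq (vars (lhs r)).

Definition right_linear (S : set rule) : Prop :=
  forall r x, S r -> x \in rhs r -> uniq (vars x.2).

Definition orthogonal_ptrs (S : set rule) : Prop :=
  non_overlapping S /\ left_linear S.

End Rewriting.

Section Adequacy.
Variable R : realType.

Lemma mset_map_perm (A B : choiceType) (f : A -> B) (mu : {mset A}) :
  perm_eq (mset_map f mu) [seq f x | x <- mu].
Proof. exact: perm_eq_seq_mset. Qed.

Lemma mbigunion_perm (A : choiceType) k (mu : 'I_k -> {mset A}) :
  perm_eq (mbigunion mu) (flatten [seq (mu j : seq A) | j <- enum 'I_k]).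
Proof.
apply/allP => a _ /=; rewrite count_mem_mset count_flatten -map_comp sumnE.
rewrite big_map big_enum /= /mbigunion; apply/eqP.
transitivity (\sum_(j < k) mu j a)%N; last first.
  by apply: eq_bigr => j _; rewrite count_mem_mset.
apply: (big_morph (fun m : {mset A} => m a)) => [m1 m2|].
  by rewrite msetE2.
by rewrite mset0E.
Qed.

Lemma mscale_union_is_mdist (A : choiceType) k (p : 'I_k -> R)
    (mu : 'I_k -> {mset R * A}) :
  (forall j, 0 < p j <= 1) -> \sum_(j < k) p j = 1 ->
  (forall j, is_mdist (mu j)) ->
  is_mdist (mbigunion (fun j => mscale (p j) (mu j))).
Proof.
move=> p01 p1 muP; split=> [x|].
  rewrite (perm_mem (mbigunion_perm _)) => /flattenP[s /mapP[j _ ->]].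
  rewrite (perm_mem (mset_map_perm _ _)) => /mapP[y yj ->] /=.
  have /andP[y0 y1] := (muP j).1 y yj; have /andP[q0 q1] := p01 j.
  by rewrite mulr_gt0 //= mulr_ile1 // ltW.
rewrite (perm_big _ (mbigunion_perm _)) /= big_flatten big_map big_enum /=.
rewrite -[RHS]p1; apply: eq_bigr => j _.
rewrite (perm_big _ (mset_map_perm _ _)) /= big_map /= -mulr_sumr.
by rewrite (muP j).2 mulr1.
Qed.

Lemma dirac_is_mdist (A : choiceType) (a : A) :
  is_mdist ([mset (1, a)] : {mset R * A}).
Proof.
split=> [x|]; first by rewrite in_mset1 => /eqP -> /=; rewrite ltr01 lexx.
by rewrite enum_msetn big_seq1.
Qed.

Lemma lifting_is_mdist (A : choiceType) (step : A -> {mset R * A} -> Prop) :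
  (forall a mu, step a mu -> is_mdist mu) ->
  forall mu nu, lifting step mu nu -> is_mdist mu /\ is_mdist nu.
Proof.
move=> stepP mu nu; elim=> [a _|a {}mu /stepP muP|k p {}mu {}nu p01 p1 _ IH].
- by split; apply: dirac_is_mdist.
- by split=> //; apply: dirac_is_mdist.
- by split; apply: mscale_union_is_mdist => // j; case: (IH j).
Qed.

Lemma full_step_is_mdist (F : signature) (V : eqType) (S : set (rule R F V)) :
  is_ptrs S -> forall s mu, full_step S s mu -> is_mdist mu.
Proof.
move=> SP s mu [pi [u [r [sigma [/SP[_ [r01 r1] _] _ _ ->]]]]].
split=> [x|]; last by rewrite (perm_big _ (mset_map_perm _ _)) /= big_map.
by rewrite (perm_mem (mset_map_perm _ _)) => /mapP[y /r01 y01 ->].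
Qed.

End Adequacy.

(* Main.v *)
(* An innermost redex does not change until it is contracted or erased,
   whatever else happens around it, and by right-linearity it has at most one
   residual. Hence a full step and an innermost step from the same term close
   a one-step diamond, except that the innermost redex may have been erased by
   the full step. Fix any memoryless innermost strategy and let w_n(t) be the
   probability that it has not reached a normal form n steps after starting in
   t. The diamond yields, by induction on n, that no full step from t gives w_n
   a larger expectation than an innermost step. So, from a given start, every
   full rewrite sequence has at each time at least as much mass on normal forms
   as the sequence following the innermost strategy. *)

Require Import Defs.
From mathcomp Require Import all_boot all_order all_algebra.
From mathcomp Require Import finmap multiset.
From mathcomp Require Import all_classical all_reals all_analysis.

Set Implicit Arguments.
Unset Strict Implicit.
Unset Printing Implicit Defensive.

Import Order.TTheory GRing.Theory Num.Theory.
Import numFieldNormedType.Exports.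

Local Open Scope classical_set_scope.
Local Open Scope ring_scope.
Local Open Scope mset_scope.

(** * Subterms and replacement at positions *)

Section Positions.
Variables (F : signature) (V : Type).
Implicit Types (s t u v w : term F V) (p q : seq nat).

Lemma subterm_at_nil t : subterm_at t [::] = Some t.
Proof. by case: t. Qed.

Lemma replace_at_nil t v : replace_at t [::] v = v.
Proof. by case: t. Qed.

Lemma subterm_at_cat t p q :
  subterm_at t (p ++ q) = obind (fun u => subterm_at u q) (subterm_at t p).
Proof.
elim: p t => [|i p IHp] [x|f ts] //=.
by case: (insub i) => // j; exact: IHp.
Qed.

Lemma replace_at_cat t p q u v : subterm_at t p = Some u ->
  replace_at t (p ++ q) v = replace_at t p (replace_at u q v).
Proof.
elim: p t => [|i p IHp] t.
  by rewrite subterm_at_nil !replace_at_nil => -[->].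
case: t => [x|f ts] //=; case: insubP => // j _ ij tsj; congr App.
apply/ffunP => k; rewrite !ffunE; case: eqP => // ki.
have -> : k = j by apply: val_inj; rewrite ij.
exact: IHp.
Qed.

Lemma subterm_at_replace_cat t p q u v : subterm_at t p = Some u ->
  subterm_at (replace_at t p v) (p ++ q) = subterm_at v q.
Proof.
elim: p t => [|i p IHp] [x|f ts] //=.
case: insubP => // j _ ij tsj; rewrite ffunE ij eqxx; exact: IHp.
Qed.

Lemma subterm_at_replace t p u v : subterm_at t p = Some u ->
  subterm_at (replace_at t p v) p = Some v.
Proof.
by move=> /(subterm_at_replace_cat [::] v); rewrite cats0 subterm_at_nil.
Qed.

Lemma replace_at_idem t p v w :
  replace_at (replace_at t p v) p w = replace_at t p w.
Proof.
elim: p t => [|i p IHp] t; first by rewrite !replace_at_nil.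
case: t => //= f ts; congr App; apply/ffunP => k.
by rewrite !ffunE; case: eqP => // _; rewrite IHp.
Qed.

Lemma subterm_at_replace_par t p q v : ~~ prefix p q -> ~~ prefix q p ->
  subterm_at (replace_at t p v) q = subterm_at t q.
Proof.
elim: p q t => [|i p IHp] [|k q] [x|f ts] //=.
case: insubP => // j _ kj; rewrite ffunE kj ![i == k]eq_sym.
by case: eqP => //= _; exact: IHp.
Qed.

Lemma replace_at_par t p q v w : ~~ prefix p q -> ~~ prefix q p ->
  replace_at (replace_at t p v) q w = replace_at (replace_at t q w) p v.
Proof.
elim: p q t => [|i p IHp] [|k q] [x|f ts] //=.
move=> pq qp; congr App; apply/ffunP => j; rewrite !ffunE.
case: (eqVneq (val j) k) pq qp => [->|//]; rewrite eq_sym.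
by case: eqP => //= _ pq qp; exact: IHp.
Qed.

End Positions.

(** * Substitutions, instances of patterns and linearity *)

Section Substitutions.
Variable F : signature.

Lemma subterm_at_subst (V W : Type) (sg : V -> term F W) (t u : term F V) p :
  subterm_at t p = Some u ->
  subterm_at (subst sg t) p = Some (subst sg u).
Proof.
elim: p t => [|i p IHp] t; first by rewrite !subterm_at_nil => -[->].
case: t => [x|f ts] //=; case: insubP => // j _ _ tsj; rewrite ffunE.
exact: IHp.
Qed.

(** Separates redexes that meet the pattern, which give overlaps, from those inside the value of a
    variable, which are contracted by changing that value. *)
Lemma subterm_at_subst_inv (V W : Type) (sg : V -> term F W) (t : term F V)
    v p :
    subterm_at (subst sg t) p = Some v ->
  (exists2 u, subterm_at t p = Some u & ~~ is_var u) \/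
  (exists x p1 p2, [/\ p = p1 ++ p2, subterm_at t p1 = Some (Var x) &
    subterm_at (sg x) p2 = Some v]).
Proof.
elim: t p => [x|f ts IHt] p /=; first by right; exists x, [::], p.
case: p => [|i p] /=; first by left; exists (App f ts).
case E: (insub i : option 'I_(arity f)) => [j|] //.
have ij : val j = i by move: E; case: insubP => // k _ <- [->].
rewrite ffunE => /IHt[]; first by left.
move=> [x [p1 [p2 [-> tsx sx]]]]; right; exists x, (i :: p1), p2; split=> //=.
by rewrite -ij valK.
Qed.

Lemma subst_subst (U V W : Type) (sg : V -> term F W) (rho : U -> term F V) t :
  subst sg (subst rho t) = subst (fun x => subst sg (rho x)) t.
Proof.
elim: t => //= f ts IHt; congr App; apply/ffunP => i.
by rewrite !ffunE IHt.
Qed.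

Variable V : eqType.
Implicit Types (s t u v : term F V) (p : seq nat).

Lemma mem_vars_App f (ts : {ffun 'I_(arity f) -> term F V}) x :
  reflect (exists i, x \in vars (ts i)) (x \in vars (App f ts)).
Proof.
apply: (iffP flatten_mapP) => [[i _ xi]|[i xi]]; first by exists i.
by exists i; rewrite // mem_enum.
Qed.

Lemma mem_vars_subterm_at t x :
  x \in vars t <-> exists p, subterm_at t p = Some (Var x).
Proof.
split.
  elim: t => [y|f ts IHt]; first by rewrite inE => /eqP ->; exists [::].
  move=> /mem_vars_App[i /IHt[p tp]]; exists (val i :: p) => /=.
  by rewrite valK.
move=> [p]; elim: p t => [|i p IHp] [y|f ts] //=.
- by move=> [->]; rewrite inE.
- by case: insubP => // j _ _ /IHp xj; apply/mem_vars_App; exists j.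
Qed.

Lemma eq_in_subst (W : Type) (sg rho : V -> term F W) t :
  {in vars t, sg =1 rho} <-> subst sg t = subst rho t.
Proof.
split=> [|E x /mem_vars_subterm_at[p tp]].
  elim: t => [x|f ts IHt] /= E; first by apply: E; rewrite inE.
  congr App; apply/ffunP => i; rewrite !ffunE; apply: IHt => x xi.
  by apply: E; apply/mem_vars_App; exists i.
have := subterm_at_subst sg tp; rewrite E (subterm_at_subst rho tp).
by case.
Qed.

Definition update (W : Type) (sg : V -> W) (x : V) (w : W) : V -> W :=
  fun y => if y == x then w else sg y.

Lemma subst_update_notin (sg : V -> term F V) t x w : x \notin vars t ->
  subst (update sg x w) t = subst sg t.
Proof.
move=> xt; apply/eq_in_subst => y yt; rewrite /update.
by case: eqP yt xt => // -> ->.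
Qed.

(** Linearity makes [p] the only occurrence of [x]. On left-hand sides this keeps a pattern matched
    after a step inside [sg x]; on right-hand sides it leaves a single residual. *)
Lemma subst_update_linear (sg : V -> term F V) t x w p :
    uniq (vars t) -> subterm_at t p = Some (Var x) ->
  subst (update sg x w) t = replace_at (subst sg t) p w.
Proof.
move=> /count_uniq_mem tx; have {tx} : (count_mem x (vars t) <= 1)%N.
  by rewrite tx leq_b1.
elim: p t => [|i p IHp] [y|f ts] //=.
  by move=> _ [->]; rewrite replace_at_nil /update eqxx.
case: insubP => // j _ ij; rewrite count_flatten -map_comp sumnE big_map.
rewrite big_enum (bigD1 j) //= => le1 tsj.
congr App; apply/ffunP => k; rewrite !ffunE -ij.
case: (eqVneq (val k) (val j)) => [/val_inj ->|kj].
  by apply: IHp tsj; apply: leq_trans le1; exact: leq_addr.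
apply: subst_update_notin; apply/count_memPn/eqP; rewrite -leqn0.
have jx : (0 < count_mem x (vars (ts j)))%N.
  by rewrite -has_count has_pred1; apply/mem_vars_subterm_at; exists p.
move: le1; rewrite (bigD1 k) //= -(prednK jx) addSn ltnS leqn0 !addn_eq0.
by case/and3P => _ /eqP ->.
Qed.

End Substitutions.

(** * Images of multisets *)

Section MsetMap.
Variables (A B C : choiceType).

Lemma big_mset_map (R : nmodType) (f : A -> B) (mu : {mset A}) (g : B -> R) :
  \sum_(x <- mset_map f mu) g x = \sum_(x <- mu) g (f x).
Proof. by rewrite (perm_big _ (mset_map_perm f mu)) big_map. Qed.

Lemma mset_map_comp (f : B -> C) (g : A -> B) (mu : {mset A}) :
  mset_map f (mset_map g mu) = mset_map (f \o g) mu.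
Proof.
apply/eq_seq_msetP; rewrite (perm_trans (perm_map f (mset_map_perm g mu))) //.
by rewrite -map_comp.
Qed.

Lemma eq_in_mset_map (f g : A -> B) (mu : {mset A}) :
  {in mu, f =1 g} -> mset_map f mu = mset_map g mu.
Proof. by move=> fg; congr seq_mset; apply/eq_in_map. Qed.

End MsetMap.

(** * Redexes and the one-step diamond *)

Section Redexes.
Variables (R : realType) (F : signature) (V : eqType) (S : set (rule R F V)).
Implicit Types (s t u v : term F V) (mu nu : {mset R * term F V}).
Implicit Types (p q : seq nat) (r : rule R F V).

Lemma innermost_step_full s mu : innermost_step S s mu -> full_step S s mu.
Proof. by move=> [p [u [H _]]]; exists p, u. Qed.

Lemma rewrites_at_cat s p q t u mu : subterm_at s p = Some t ->
    rewrites_at S q t u mu ->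
  rewrites_at S (p ++ q) s u
    (mset_map (fun x => (x.1, replace_at s p x.2)) mu).
Proof.
move=> sp [r [sg [Sr uE tq ->]]]; exists r, sg; split=> //.
  by rewrite subterm_at_cat sp.
rewrite mset_map_comp; apply: eq_in_mset_map => x _ /=.
by rewrite (replace_at_cat _ _ sp).
Qed.

Lemma nf_subterm s p t : nf S s -> subterm_at s p = Some t -> nf S t.
Proof.
move=> snf sp [mu [q [u /(rewrites_at_cat sp) H]]]; apply: snf.
by eexists; exists (p ++ q), u; exact: H.
Qed.

Hypothesis ptrsS : is_ptrs S.

(** Descend into a reducible argument while there is one; once all arguments are normal forms, the
    redex must sit at the root and is innermost. *)
Lemma full_step_innermost s mu :
  full_step S s mu -> exists nu, innermost_step S s nu.
Proof.
elim: s mu => [x|f ts IHts] mu.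
  move=> [p [u [r [sg [Sr uE]]]]]; have [+ _ _] := ptrsS Sr.
  case: p => // + [] uE'; rewrite -uE' in uE.
  by case: (lhs r) uE.
have [[i nfi]|nf_args] := pselect (exists i, ~ nf S (ts i)).
  move=> _; have [_ /IHts[nu [q [u [H inn]]]]] := contrapT nfi.
  eexists; exists (val i :: q), u; split=> //.
  have sp : subterm_at (App f ts) [:: val i] = Some (ts i).
    by rewrite /= valK subterm_at_nil.
  exact: rewrites_at_cat sp H.
have {}nf_args i : nf S (ts i).
  by apply: contrapT => ?; apply: nf_args; exists i.
have nf_sub p t : p <> [::] -> subterm_at (App f ts) p = Some t -> nf S t.
  case: p => // i p _ /=; case: insubP => // j _ _; exact: nf_subterm.
move=> [p [u H]]; case: p H => [|i p] H.
  exists mu, [::], u; split=> // q v; case: H => r [sg [_ _ + _]].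
  by rewrite subterm_at_nil => -[<-]; exact: nf_sub.
exfalso; case: H => r [sg [Sr uE su _]]; apply: (nf_sub _ _ _ su) => //.
eexists; exists [::], u, r, sg; split=> //; exact: subterm_at_nil.
Qed.

Lemma nf_innermost t : normal_form (innermost_step S) t <-> nf S t.
Proof.
split=> tnf [mu H]; apply: tnf.
- exact: full_step_innermost H.
- by exists mu; exact: innermost_step_full.
Qed.

Lemma overlap_subst r1 r2 p u (sg1 sg2 : V -> term F V) :
    subterm_at (lhs r1) p = Some u -> ~~ is_var u ->
    (r1 = r2 -> p <> [::]) -> subst sg1 u = subst sg2 (lhs r2) ->
  overlap r1 r2.
Proof.
move=> r1p uv r12 E; exists p, u; split=> //.
(* The unifier acts as [sg1] on the left copy of the variables and as [sg2] on the right one; the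
   outer [inl] only embeds the values into terms over [V + V]. *)
exists (fun x => subst (fun y => Var (inl y))
                   (match x with inl y => sg1 y | inr y => sg2 y end)).
by rewrite !subst_subst /= -!subst_subst E.
Qed.

Hypothesis non_overlappingS : non_overlapping S.

(** Two different rules with a common redex would overlap at the root. *)
Lemma redex_unique r1 r2 (sg1 sg2 : V -> term F V) : S r1 -> S r2 ->
    subst sg1 (lhs r1) = subst sg2 (lhs r2) ->
  r1 = r2 /\ {in vars (lhs r1), sg1 =1 sg2}.
Proof.
move=> Sr1 Sr2 E; suff r12 : r1 = r2.
  by split=> //; apply/eq_in_subst; rewrite E r12.
apply: contrapT => r12; apply: (non_overlappingS Sr1 Sr2).
have [nv _ _] := ptrsS Sr1.
by apply: (overlap_subst (subterm_at_nil _) nv) E.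
Qed.

Hypotheses (left_linearS : left_linear S) (right_linearS : right_linear S).

(* [I] and [J] are the right-hand sides of the two rules applied, and
   [c x y] is the outcome of doing both steps. The second alternative of the
   last conjunct is the case of an innermost redex erased by the other rule. *)
Lemma innermost_diamond s mu nu : full_step S s mu -> innermost_step S s nu ->
  mu = nu \/
  exists (I J : {mset R * term F V}) (a b : R * term F V -> term F V)
         (c : R * term F V -> R * term F V -> term F V),
    [/\ is_mdist I, is_mdist J,
        mu = mset_map (fun x => (x.1, a x)) I
          /\ nu = mset_map (fun y => (y.1, b y)) J,
        forall y, full_step S (b y) (mset_map (fun x => (x.1, c x y)) I) &
        forall x, x \in I ->
          innermost_step S (a x) (mset_map (fun y => (y.1, c x y)) J) \/
          forall y, c x y = a x].
Proof.
move=> [p [u2 [r2 [sg2 [Sr2 u2E sp ->]]]]].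
move=> [q [u1 [[r1 [sg1 [Sr1 u1E sq ->]]] inn]]].
have [_ mdr1 var1] := ptrsS Sr1; have [_ mdr2 var2] := ptrsS Sr2.
have [/prefixP[q' qE]|pq] := boolP (prefix p q); last first.
  have [/prefixP[p' pE]|qp] := boolP (prefix q p).
    (* A full redex strictly inside the innermost redex would be a reducible proper subterm of
       it. *)
    exfalso; have u1p' : subterm_at u1 p' = Some u2.
      by move: sp; rewrite pE subterm_at_cat sq.
    apply: (inn _ _ _ u1p').
      by move=> p'0; rewrite pE p'0 cats0 prefix_refl in pq.
    by eexists; exists [::], u2, r2, sg2; split=> //; exact: subterm_at_nil.
  right; exists (rhs r2), (rhs r1).
  exists (fun x => replace_at s p (subst sg2 x.2)).
  exists (fun y => replace_at s q (subst sg1 y.2)).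
  exists (fun x y =>
    replace_at (replace_at s p (subst sg2 x.2)) q (subst sg1 y.2)).
  split=> // [y|x _].
    exists p, u2, r2, sg2; split=> //; first by rewrite subterm_at_replace_par.
    by apply: eq_in_mset_map => x _; rewrite replace_at_par.
  left; exists q, u1; split=> //; exists r1, sg1; split=> //.
  by rewrite subterm_at_replace_par.
subst q; have u2q : subterm_at u2 q' = Some u1.
  by move: sq; rewrite subterm_at_cat sp.
have [q'0|q'0] := eqVneq q' [::].
  (* Same redex, hence same rule and same result. *)
  left; subst q'; rewrite cats0.
  move: u2q; rewrite subterm_at_nil u2E u1E => -[].
  move=> /(redex_unique Sr2 Sr1)[r21 sg21]; subst r2.
  apply: eq_in_mset_map => x xr; congr (_, replace_at _ _ _).
  by apply/eq_in_subst => z /(var1 _ xr) /sg21.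
right; move: (u2q); rewrite u2E.
move=> /subterm_at_subst_inv[[u r2q' uv]|[z [q1 [q2 [q'E r2q1 zq2]]]]].
  (* Here the innermost redex starts at a function symbol of the pattern of [r2], below its root
     since [q'] is nonempty: an overlap. *)
  exfalso; apply: (non_overlappingS Sr2 Sr1).
  have E : subst sg2 u = subst sg1 (lhs r1).
    move: u2q; rewrite u2E (subterm_at_subst sg2 r2q') u1E.
    by case.
  by apply: overlap_subst r2q' uv _ E => _; apply/eqP.
(* The innermost redex lies inside the value of [z]; [w y] is that value once the redex is
   contracted to the outcome [y]. *)
pose w (y : R * term F V) := replace_at (sg2 z) q2 (subst sg1 y.2).
exists (rhs r2), (rhs r1).
exists (fun x => replace_at s p (subst sg2 x.2)).
exists (fun y => replace_at s (p ++ q') (subst sg1 y.2)).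
exists (fun x y => replace_at s p (subst (update sg2 z (w y)) x.2)).
split=> // [y|x xr].
  (* By left-linearity the contracted term is still an instance of [lhs r2]. *)
  have -> : replace_at s (p ++ q') (subst sg1 y.2) =
            replace_at s p (subst (update sg2 z (w y)) (lhs r2)).
    rewrite (replace_at_cat _ _ sp) u2E q'E.
    rewrite (replace_at_cat _ _ (subterm_at_subst sg2 r2q1)) /=.
    by rewrite (subst_update_linear _ _ (left_linearS Sr2) r2q1).
  eexists; eexists; exists r2, (update sg2 z (w y)); split=> //.
    exact: subterm_at_replace sp.
  by apply: eq_in_mset_map => x _; rewrite replace_at_idem.
(* If [z] is absent from [x.2], the innermost redex is erased; otherwise right-linearity leaves one
   residual, at [p ++ k ++ q2]. *)
have [zx|zx] := boolP (z \in vars x.2); last first.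
  by right=> y; rewrite subst_update_notin.
left; have /mem_vars_subterm_at[k xk] := zx.
exists (p ++ k ++ q2), u1; split=> //; exists r1, sg1; split=> //.
  rewrite (subterm_at_replace_cat _ _ sp) subterm_at_cat.
  by rewrite (subterm_at_subst sg2 xk).
apply: eq_in_mset_map => y _ /=; congr (_, _).
rewrite (replace_at_cat _ _ (subterm_at_replace _ sp)) replace_at_idem.
rewrite (replace_at_cat _ _ (subterm_at_subst sg2 xk)) /=.
by rewrite (subst_update_linear _ _ (right_linearS Sr2 xr) xk).
Qed.

End Redexes.

(** * Expectations over multi-distributions and the lifting *)

Section Expectation.
Variables (R : realType) (A : choiceType).
Implicit Types (g h : A -> R) (mu nu : {mset R * A}).

Definition expect g mu : R := \sum_(x <- mu) x.1 * g x.2.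

Lemma expect_mset1 g a : expect g [mset (1, a)] = g a.
Proof. by rewrite /expect enum_msetn big_seq1 mul1r. Qed.

Lemma expect_mset_map g (f : R * A -> A) mu :
  expect g (mset_map (fun x => (x.1, f x)) mu) = \sum_(x <- mu) x.1 * g (f x).
Proof. exact: big_mset_map. Qed.

Lemma expect_mscale_union g k (p : 'I_k -> R) (mu : 'I_k -> {mset R * A}) :
  expect g (mbigunion (fun j => Defs.mscale (p j) (mu j))) =
  \sum_(j < k) p j * expect g (mu j).
Proof.
rewrite /expect (perm_big _ (mbigunion_perm _)) big_flatten big_map big_enum.
apply: eq_bigr => j _; rewrite big_mset_map mulr_sumr.
by apply: eq_bigr => x _; rewrite mulrA.
Qed.

Lemma mdist_sum_le (g h : R * A -> R) mu : is_mdist mu ->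
    (forall x, x \in mu -> g x <= h x) ->
  \sum_(x <- mu) x.1 * g x <= \sum_(x <- mu) x.1 * h x.
Proof.
move=> [mu01 _] gh; rewrite big_seq [leRHS]big_seq; apply: ler_sum => x xmu.
by rewrite ler_wpM2l ?gh //; have /andP[/ltW] := mu01 _ xmu.
Qed.

Lemma mdist_sum_cst c mu : is_mdist mu -> \sum_(x <- mu) x.1 * c = c.
Proof. by move=> [_ mu1]; rewrite -mulr_suml mu1 mul1r. Qed.

(** Realises a strategy [f] as a lifted step: [mu] is the convex combination of the point masses of
    its pairs, each of which moves on its own. *)
Lemma lifting_pointwise (step : A -> {mset R * A} -> Prop)
    (f : A -> {mset R * A}) mu :
    (forall a, lifting step [mset (1, a)] (f a)) -> is_mdist mu ->
  lifting step mu (mbigunion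
    (fun j => Defs.mscale (tnth (in_tuple mu) j).1
                (f (tnth (in_tuple mu) j).2))).
Proof.
move=> stepf [mu01 mu1]; set t := in_tuple mu.
have {1}-> : mu = mbigunion
    (fun j => Defs.mscale (tnth t j).1 [mset (1, (tnth t j).2)]).
  rewrite -[LHS]seq_mset_id -[RHS]seq_mset_id; apply/eq_seq_msetP.
  rewrite perm_sym (perm_trans (mbigunion_perm _)) //.
  have -> : [seq (Defs.mscale (tnth t j).1 [mset (1, (tnth t j).2)] : seq _)
             | j <- enum 'I_(size mu)] =
            [seq [:: tnth t j] | j <- enum 'I_(size mu)].
    apply: eq_map => j; apply: perm_small_eq => //.
    rewrite (perm_trans (mset_map_perm _ _)) // enum_msetn /= mulr1.
    by rewrite -surjective_pairing.
  by rewrite flatten_map1 map_tnth_enum.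
apply: lifting_union => [j||j]; [exact/mu01/mem_tnth| |exact: stepf].
by rewrite -[RHS]mu1 (big_tnth _ _ (mu : seq _)).
Qed.

End Expectation.

(** More steps can mean fewer normal forms, so the case [lifting_nf] needs its own hypothesis. *)
Lemma lifting_mono (R : realType) (A : choiceType)
    (step1 step2 : A -> {mset R * A} -> Prop) :
    (forall a mu, step1 a mu -> step2 a mu) ->
    (forall a, normal_form step1 a -> normal_form step2 a) ->
  forall mu nu, lifting step1 mu nu -> lifting step2 mu nu.
Proof.
move=> step12 nf12 mu nu; elim=> [a /nf12|a {}mu /step12|].
- exact: lifting_nf.
- exact: lifting_step.
- by move=> k p {}mu {}nu p01 p1 _ IH; exact: lifting_union.
Qed.

(** * Comparing full rewriting with a fixed innermost strategy *)

Section Domination.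
Variables (R : realType) (F : signature) (V : eqType) (S : set (rule R F V)).
Hypotheses (ptrsS : is_ptrs S) (non_overlappingS : non_overlapping S).
Hypotheses (left_linearS : left_linear S) (right_linearS : right_linear S).
Implicit Types (s t : term F V) (mu nu : {mset R * term F V}).

(** A memoryless innermost strategy, made total by letting terms without an innermost step stay
    put. *)
Definition chosen_step t : {mset R * term F V} :=
  if pselect (exists mu, innermost_step S t mu) is left inn
  then projT1 (cid inn)
  else [mset (1, t)].

Lemma chosen_step_innermost t mu :
  full_step S t mu -> innermost_step S t (chosen_step t).
Proof.
move=> /(full_step_innermost ptrsS)[nu tnu]; rewrite /chosen_step.
case: pselect => [inn|[]]; last by exists nu.
exact: (projT2 (cid inn)).
Qed.

Lemma chosen_step_nf t : nf S t -> chosen_step t = [mset (1, t)].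
Proof.
rewrite /chosen_step; case: pselect => // inn.
by move=> /(nf_innermost ptrsS) /(_ inn).
Qed.

Lemma lifting_chosen_step t :
  lifting (innermost_step S) [mset (1, t)] (chosen_step t).
Proof.
rewrite /chosen_step; case: pselect => [inn|]; last exact: lifting_nf.
exact/lifting_step/(projT2 (cid inn)).
Qed.

Lemma innermost_step_is_mdist t mu : innermost_step S t mu -> is_mdist mu.
Proof.
by move=> /innermost_step_full; exact: (full_step_is_mdist ptrsS).
Qed.

Lemma chosen_step_is_mdist t : is_mdist (chosen_step t).
Proof.
by have [] := lifting_is_mdist innermost_step_is_mdist (lifting_chosen_step t).
Qed.

(* Probability that the innermost strategy [chosen_step], started in [t], has
   not reached a normal form after [n] steps. *)
Fixpoint survival n t : R :=
  if n is m.+1 then expect (survival m) (chosen_step t)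
  else (~~ `[< nf S t >])%:R.

Lemma survival_nf n t : nf S t -> survival n t = 0.
Proof.
elim: n t => [|n IHn] t tnf /=; first by rewrite asboolT.
by rewrite chosen_step_nf // expect_mset1 IHn.
Qed.

Lemma survival0_step t mu : full_step S t mu -> survival 0 t = 1.
Proof. by move=> tmu /=; rewrite asboolF // => tnf; apply: tnf; exists mu. Qed.

Lemma survival_le1 n t : survival n t <= 1.
Proof.
elim: n t => [|n IHn] t /=; first by rewrite lern1 leq_b1.
rewrite -[leRHS](mdist_sum_cst 1 (chosen_step_is_mdist t)).
exact: mdist_sum_le (chosen_step_is_mdist t) _.
Qed.

(** Serves the erased redex of the diamond, where the strategy has one step to spare. *)
Lemma survivalS_le n t : survival n.+1 t <= survival n t.
Proof.
elim: n t => [|n IHn] t.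
  have [tnf|/contrapT[mu tmu]] := pselect (nf S t).
    by rewrite !survival_nf.
  by rewrite (survival0_step tmu) survival_le1.
by apply: (mdist_sum_le (chosen_step_is_mdist t)) => x _; exact: IHn.
Qed.

(** [nu] is an arbitrary innermost step because the residual given by the diamond need not be the
    chosen one; the induction hypothesis compares the chosen step, taken as a full step, with that
    residual. *)
Lemma expect_survival_step n s mu nu :
    full_step S s mu -> innermost_step S s nu ->
  expect (survival n) mu <= expect (survival n) nu.
Proof.
elim: n s mu nu => [|n IHn] s mu nu smu snu;
  have [-> //|] := innermost_diamond ptrsS non_overlappingS left_linearS
    right_linearS smu snu;
  move=> [I [J [a [b [c [mdI mdJ [-> ->] bc ac]]]]]]; rewrite !expect_mset_map.
  (* Every [b y] is reducible, so the right-hand side is [1]. *)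
  under [leRHS]eq_bigr => y _ do rewrite (survival0_step (bc y)).
  rewrite (mdist_sum_cst _ mdJ) -[leRHS](mdist_sum_cst 1 mdI).
  by apply: mdist_sum_le mdI _ => x _; exact: survival_le1.
(* Pass through the common outcomes [c x y], with one step fewer left. *)
apply: (@le_trans _ _
    (\sum_(x <- I) x.1 * \sum_(y <- J) y.1 * survival n (c x y))).
  apply: mdist_sum_le mdI _ => x /ac[axc|cax].
    rewrite -expect_mset_map; apply: (IHn _ _ _ _ axc).
    exact/innermost_step_full/(chosen_step_innermost (innermost_step_full axc)).
  rewrite (le_trans (survivalS_le _ _)) //.
  under eq_bigr => y _ do rewrite cax.
  by rewrite mdist_sum_cst.
(* Exchange the sums: each inner sum becomes an expectation after the full step from [b y]. *)
under eq_bigr => x _ do rewrite mulr_sumr.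
rewrite exchange_big /=.
under eq_bigr => y _ do under eq_bigr => x _ do rewrite mulrCA.
under eq_bigr => y _ do rewrite -mulr_sumr.
apply: mdist_sum_le mdJ _ => y _; rewrite -expect_mset_map.
exact: IHn (bc y) (chosen_step_innermost (bc y)).
Qed.

(** Unfolding [survival n.+1] makes one chosen step, whose expected survival no full step exceeds;
    normal forms give [0] on both sides. *)
Lemma expect_survival_lifting n mu nu : lifting (full_step S) mu nu ->
  expect (survival n) nu <= expect (survival n.+1) mu.
Proof.
elim=> [t tnf|t {}mu tmu|k p {}mu {}nu p01 _ _ IH].
- by rewrite !expect_mset1 !survival_nf.
- rewrite expect_mset1.
  exact: expect_survival_step tmu (chosen_step_innermost tmu).
rewrite !expect_mscale_union; apply: ler_sum => j _.
by rewrite ler_wpM2l //; have /andP[/ltW] := p01 j.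
Qed.

Lemma prob_nf_survival mu : is_mdist mu ->
  prob_nf S mu = 1 - expect (survival 0) mu.
Proof.
move=> [_ <-]; apply/eqP; rewrite eq_sym subr_eq; apply/eqP.
rewrite (bigID (fun x => `[< nf S x.2 >])) /=; congr (_ + _).
rewrite big_mkcond; apply: eq_bigr => x _.
by case: ifP => _; rewrite ?mulr1 ?mulr0.
Qed.

Definition chosen_lifting mu : {mset R * term F V} :=
  mbigunion (fun j => Defs.mscale (tnth (in_tuple mu) j).1
                        (chosen_step (tnth (in_tuple mu) j).2)).

Lemma expect_chosen_lifting n mu :
  expect (survival n) (chosen_lifting mu) = expect (survival n.+1) mu.
Proof.
rewrite expect_mscale_union /expect [RHS](big_tnth _ _ (mu : seq _)).
by apply: eq_bigr.
Qed.

Lemma full_dominated_by_innermost (mu : nat -> {mset R * term F V}) :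
    lifting_sequence (full_step S) mu ->
  exists2 nu, lifting_sequence (innermost_step S) nu &
    forall n, prob_nf S (nu n) <= prob_nf S (mu n).
Proof.
(* From the same start, [nu] lets every term follow the strategy. *)
move=> stepmu; pose nu n := iter n chosen_lifting (mu 0%N).
have mdmu n : is_mdist (mu n).
  by have [] := lifting_is_mdist (full_step_is_mdist ptrsS) (stepmu n).
have mdnu n : is_mdist (nu n) /\ lifting (innermost_step S) (nu n) (nu n.+1).
  have lift m : is_mdist (nu m) -> lifting (innermost_step S) (nu m) (nu m.+1).
    exact: lifting_pointwise lifting_chosen_step.
  elim: n => [|n [_ nuS]]; first by split; [|apply: lift]; exact: mdmu.
  have [_ mdnuS] := lifting_is_mdist innermost_step_is_mdist nuS.
  by split=> //; exact: lift.
exists nu => n; first by case: (mdnu n).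
rewrite !prob_nf_survival //; last by case: (mdnu n).
(* The horizon [0] is generalised, since going back one step in either sequence raises it by one. *)
rewrite lerD2l lerN2; move: (0%N).
elim: n => [|n IHn] m //.
rewrite expect_chosen_lifting (le_trans _ (IHn _)) //.
exact: expect_survival_lifting.
Qed.

Lemma prob_nf_le1 mu : is_mdist mu -> prob_nf S mu <= 1.
Proof.
move=> mdmu; rewrite prob_nf_survival // gerBl.
rewrite -[leLHS](mdist_sum_cst 0 mdmu).
by apply: mdist_sum_le mdmu _ => x _; exact: ler0n.
Qed.

End Domination.

Theorem theorem4p2 (R : realType) (F : signature) (V : eqType)
    (S : set (rule R F V)) (HS : is_ptrs S)
    (Hort : orthogonal_ptrs S) (Hrl : right_linear S) :
  (fAST S <-> iAST S) /\ (fPAST S <-> iPAST S).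
Proof.
have [Hno Hll] := Hort.
have inn_full mu : lifting_sequence (innermost_step S) mu ->
    lifting_sequence (full_step S) mu.
  move=> stepmu n; apply: lifting_mono (stepmu n) => [s nu|s].
  - exact: innermost_step_full.
  - by move=> /(nf_innermost HS).
have le1 mu n : lifting_sequence (full_step S) mu -> prob_nf S (mu n) <= 1.
  move=> /(_ n) stepmu; apply: prob_nf_le1.
  by have [] := lifting_is_mdist (full_step_is_mdist HS) stepmu.
have dom := full_dominated_by_innermost HS Hno Hll Hrl.
split; split=> [full mu /inn_full /full //|inn mu stepmu].
- have [nu /inn nu1 numu] := dom mu stepmu.
  (* The mass of [mu n] on normal forms is squeezed between that of [nu n] and [1]. *)
  have cst1 : (fun=> 1 : R) n @[n --> \oo] --> (1 : R) by exact: cvg_cst.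
  by apply: squeeze_cvgr nu1 cst1; apply: nearW => n; rewrite numu le1.
- have [nu /inn nu_fin numu] := dom mu stepmu.
  apply: le_lt_trans nu_fin; apply: lee_nneseries => n _.
  + by rewrite lee_fin subr_ge0 le1.
  + by rewrite lee_fin lerD2l lerN2 numu.
Qed.
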